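(* Let $f\in\mathbb{R}[X_1,\ldots,X_n]$ be a symmetric polynomial of degree $d$. Then: (1) $f(y)\ge 0$ for all $y\in\mathbb{R}^n$ if and only if $f(\tilde y)\ge 0$ for all $\tilde y\in A_k$, where $k=\max\{2,\lfloor d/2\rfloor\}$. (2) $f(y)\ge 0$ for all $y\in\mathbb{R}^n_{\ge 0}$ if and only if $f(\tilde y)\ge 0$ for all $\tilde y\in A_k^+$, where $k=\max\{1,\lfloor d/2\rfloor\}$. (3) The set $V:=\{y\in\mathbb{R}^n: f(y)=0\}$ is non-empty if and only if $V\cap A_k\neq\emptyset$, where $k=\max\{2,\lfloor d/2\rfloor\}$.
   Context: A polynomial in $\mathbb{R}[X_1,\ldots,X_n]$ is symmetric if it is invariant under all permutations of the variables. For $x=(x_1,\ldots,x_n)\in\mathbb{R}^n$ let $\pi(x):=|\{x_1,\ldots,x_n\}|$ be the number of distinct coordinates of $x$ and $\pi^+(x):=|\{x_1,\ldots,x_n\}\cap\mathbb{R}_{>0}|$ the number of distinct positive coordinates of $x$. For a positive integer $k$ set $A_k:=\{x\in\mathbb{R}^n: \pi(x)\le k\}$ and $A_k^+:=\{x\in\mathbb{R}^n_{\ge 0}: \pi^+(x)\le k\}$. *)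

(* Defs.v *)
From mathcomp Require Import all_boot all_order all_algebra.
From mathcomp Require Import boolp classical_sets reals.
(* The notations of mpoly clash with those of mathcomp-analysis. *)
From mathcomp.multinomials Require Import -(notations) mpoly.

Set Implicit Arguments.
Unset Strict Implicit.
Unset Printing Implicit Defensive.

Import Order.TTheory GRing.Theory Num.Theory.
Local Open Scope ring_scope.
Local Open Scope classical_set_scope.

(* A point of R^n is a function 'I_n -> R, the type of valuations expected by
   [meval]. *)

Definition num_distinct (R : realType) (n : nat) (x : 'I_n -> R) : nat :=
  size (undup (codom x)).

Definition num_distinct_pos (R : realType) (n : nat) (x : 'I_n -> R) : nat :=
  size (undup [seq t <- codom x | 0 < t]).

Definition nonneg_orthant (R : realType) (n : nat) : set ('I_n -> R) :=
  [set x | forall i, 0 <= x i].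

Definition Aset (R : realType) (n k : nat) : set ('I_n -> R) :=
  [set x | (num_distinct x <= k)%N].

Definition Aset_pos (R : realType) (n k : nat) : set ('I_n -> R) :=
  nonneg_orthant (n := n) `&` [set x | (num_distinct_pos x <= k)%N].

Definition zero_locus (R : realType) (n : nat) (f : mpoly n R) :
    set ('I_n -> R) :=
  [set y | meval y f = 0].

(* [msize f] is the total degree plus one when f != 0, and it is 0 when
   f = 0, so the zero polynomial gets degree 0. *)
Definition degree (R : realType) (n : nat) (f : mpoly n R) : nat :=
  (msize f).-1.

(* Main.v *)
Require Import Defs.
From mathcomp Require Import all_boot all_order all_algebra.
From mathcomp Require Import boolp classical_sets reals.
From mathcomp Require Import topology normedtype derive realfun.
From mathcomp.multinomials Require Import -(notations) mpoly.
From mathcomp Require Import lra zify.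

Set Implicit Arguments.
Unset Strict Implicit.
Unset Printing Implicit Defensive.

Import Order.TTheory GRing.Theory Num.Theory.
Import numFieldNormedType.Exports.
Local Open Scope ring_scope.
Local Open Scope classical_set_scope.

(** The half-degree principle rests on reading a point x of R^n as the monic
real-rooted polynomial F = prod_i (T - x_i), whose coefficients are, up to
sign, the elementary symmetric values e_1(x), ..., e_n(x).

Let f be symmetric of degree d < 2(k+1).  By the fundamental theorem
f = t(e_1, ..., e_n), where every monomial of t has weight at most d when e_i
has weight i.  Two factors e_i, e_j with i, j > k would already weigh more than
d, so f is affine in e_(k+1), ..., e_n once e_1, ..., e_k are frozen; in
particular [sym_midpoint] holds.

Given y, let K be the set of admissible points with the same e_1, ..., e_k as
y.  It is compact, because a power sum of degree at most k depends on
e_1, ..., e_k only: the sum of the squares when k >= 2, the sum of the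
coordinates when k >= 1 and the coordinates are nonnegative.  Let x minimise f
on K and, among all minimisers, maximise N(x) = sum_i e_i(x)^2.  If x had
r > k distinct (positive) coordinates, then F = P Q, where P is the product of
T - c over these r values c.  Since the roots of P are simple, P + t is still
split with roots close to those of P when t is small
([perturb_simple_roots]), hence Q (P + t) and Q (P - t) are the polynomials of
two points.  As deg Q = n - r < n - k, these two points lie in K
([codom_perturbation]).  Their values of f average to f(x), so both are
minimisers; but N is strictly convex, so one of them has a larger N than x, a
contradiction.  This is [half_degree_descent]: every value f(y) is bounded
below by a value f(x) at a point x with at most k distinct (positive)
coordinates.

The statements on nonnegativity follow at once.  For the real zeros, the
descent applied to f and to - f gives points of A_k where f is <= 0 and where
f is >= 0.  The set A_k is a cone, so a zero of f in A_k is found by the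
intermediate value theorem on the segment from the origin to whichever of these
points has sign opposite to f(0). *)

(** * Perturbation of simple real roots *)

Lemma uniform_radius (R : realFieldType) (T : eqType) (A : T -> R -> Prop)
    (s : seq T) :
  (forall c r r', A c r -> 0 < r' <= r -> A c r') ->
  {in s, forall c, exists2 r, 0 < r & A c r} ->
  exists2 r, 0 < r & {in s, forall c, A c r}.
Proof.
move=> Adown; elim: s => [|c s IHs] As; first by exists 1.
have [r r_gt0 Ar] := As c (mem_head _ _).
have [c' s_c'|r' r'_gt0 Ar'] := IHs.
  by apply: As; rewrite in_cons s_c' orbT.
exists (Num.min r r'); first by rewrite lt_min r_gt0.
move=> z; rewrite in_cons => /predU1P[->|/Ar' Azr'].
  by apply: Adown Ar _; rewrite lt_min r_gt0 r'_gt0 ge_min lexx.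
by apply: Adown Azr' _; rewrite lt_min r_gt0 r'_gt0 ge_min lexx orbT.
Qed.

Lemma poly_ivt_sign (R : rcfType) (p : {poly R}) (a b : R) :
  a <= b -> p.[a] * p.[b] <= 0 -> exists2 x, a <= x <= b & root p x.
Proof.
move=> le_ab pab_le0; have [pa_le0|pa_gt0] := lerP p.[a] 0.
  have [pb_ge0|pb_lt0] := lerP 0 p.[b].
    by apply: poly_ivt; rewrite ?pa_le0.
  exists a; rewrite ?lexx //; apply/rootP/eqP.
  by rewrite eq_le pa_le0 -(nmulr_lle0 _ pb_lt0).
have [x xab] : exists2 x, a <= x <= b & root (- p) x.
  apply: poly_ivt; rewrite // !hornerN oppr_le0 (ltW pa_gt0) oppr_ge0.
  by rewrite -(pmulr_rle0 _ pa_gt0).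
by rewrite rootN; exists x.
Qed.

(** Around each simple root the polynomial changes sign on a small interval; a
small constant does not destroy these sign changes, and the intervals are
disjoint, so the perturbed polynomial has as many distinct roots as its
degree. *)
Lemma perturb_simple_roots (R : rcfType) (U : pred R) (a : seq R) :
  uniq a -> (0 < size a)%N ->
  {in a, forall c, exists2 r, 0 < r & forall b, `|b - c| <= r -> U b} ->
  exists2 e, 0 < e & forall t, `|t| <= e ->
    exists b : seq R, [/\ size b = size a, all U b &
      \prod_(c <- b) ('X - c%:P) = \prod_(c <- a) ('X - c%:P) + t%:P].
Proof.
move=> a_uniq a_gt0 aU; set P := \prod_(c <- a) _.
have [r r_gt0 rU] : exists2 r, 0 < r &
    {in a, forall c b, `|b - c| <= r -> U b}.
  apply: uniform_radius aU => c r1 r2 r1U /andP[_ le_r21] b b_c.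
  by apply: r1U; exact: le_trans le_r21.
have [r' r'_gt0 r'_sep] : exists2 r, 0 < r &
    {in a, forall c c', c' \in a -> c != c' -> 2 * r < `|c - c'|}.
  apply: uniform_radius => [c r1 r2 + /andP[r2_gt0 le_r21] c' c'a cc'|c ca].
    by move=> /(_ c' c'a cc'); apply: le_lt_trans; rewrite ler_pM2l.
  apply: uniform_radius => [c' r1 r2 + /andP[r2_gt0 le_r21] cc'|c' c'a].
    by move=> /(_ cc'); apply: le_lt_trans; rewrite ler_pM2l.
  have [->|ncc'] := eqVneq c c'; first by exists 1.
  have: 0 < `|c - c'| by rewrite normr_gt0 subr_eq0.
  by move=> h; exists (`|c - c'| / 4%:R) => [|_]; lra.
(* [d] keeps the intervals [c - d, c + d] disjoint and inside [U]. *)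
pose d := Num.min r r'.
have d_gt0 : 0 < d by rewrite lt_min r_gt0.
have dU c b : c \in a -> `|b - c| <= d -> U b.
  by move=> ca bd; apply: rU ca _ _; rewrite (le_trans bd) // ge_min lexx.
have d_sep c c' : c \in a -> c' \in a -> c != c' -> 2 * d < `|c - c'|.
  move=> ca c'a /(r'_sep _ ca _ c'a); apply: le_lt_trans.
  by rewrite ler_pM2l // ge_min lexx orbT.
clearbody d.
have P_change c : c \in a -> P.[c - d] * P.[c + d] < 0.
  move=> ca; rewrite /P (perm_big _ (perm_to_rem ca)) big_cons !hornerM.
  (* The factor of [c] contributes - d^2, the one of another root [c'] the
     positive number (c - c')^2 - d^2. *)
  rewrite mulrACA !hornerXsubC pmulr_llt0.
    by rewrite addrC addKr addrC addKr mulNr oppr_lt0 mulr_gt0.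
  rewrite !horner_prod -big_split /=; rewrite big_seq prodr_gt0 // => c'.
  rewrite mem_rem_uniq // inE => /andP[c'c c'a]; rewrite !hornerXsubC.
  have := d_sep _ _ ca c'a; rewrite eq_sym => /(_ c'c).
  by case: ger0P => h h'; [rewrite mulr_gt0|rewrite nmulr_rgt0]; lra.
have [e e_gt0 eP] : exists2 e, 0 < e &
    {in a, forall c, e <= `|P.[c - d]| /\ e <= `|P.[c + d]|}.
  apply: uniform_radius => [c r1 r2 [h1 h2] /andP[_ le21]|c /P_change h].
    by split; apply: le_trans le21 _.
  exists (Num.min `|P.[c - d]| `|P.[c + d]|).
    rewrite lt_min !normr_gt0 -negb_or; apply: contraTN h.
    by move=> /orP[]/eqP->; rewrite ?mul0r ?mulr0 ltxx.
  by rewrite !ge_min !lexx orbT.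
exists e => // t te; set Pt := P + t%:P.
have /choice[g gP] : forall c, exists z, c \in a -> `|z - c| <= d /\ root Pt z.
  move=> c.
  have [ca|_] := boolP (c \in a); last by exists c.
  have [||x /andP[x1 x2] x3] := @poly_ivt_sign _ Pt (c - d) (c + d).
  - by lra.
  - rewrite !hornerE; have [] := eP c ca; have := P_change c ca; move: te.
    set u := P.[_]; set v := P.[_]; clearbody u v; move=> te uv ue ve.
    have [u0|u0] := lerP 0 u.
      have v0 : v < 0 by rewrite ltNge; apply/negP => v0; nra.
      move: te ue ve; rewrite (ger0_norm u0) (ltr0_norm v0) ler_norml.
      by move=> /andP[]; nra.
    have v0 : 0 < v by rewrite ltNge; apply/negP => v0; nra.
    move: te ue ve; rewrite (ltr0_norm u0) (gtr0_norm v0) ler_norml.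
    by move=> /andP[]; nra.
  by exists x => _; split => //; rewrite ler_norml; lra.
exists (map g a); split; first by rewrite size_map.
  by rewrite all_map; apply/allP => c ca /=; apply: dU ca (proj1 (gP c ca)).
have sizeP : size P = (size a).+1 by exact: size_prod_XsubC.
have tP : (size t%:P < size P)%N.
  by rewrite sizeP (leq_ltn_trans (size_polyC_leq1 _)).
have := @all_roots_prod_XsubC _ Pt (map g a).
rewrite /Pt size_polyDl // size_map lead_coefDl //.
rewrite (monicP (monic_prod_XsubC _ _ _)) scale1r => -> //.
  by rewrite all_map; apply/allP => c ca; exact: (proj2 (gP c ca)).
rewrite uniq_rootsE map_inj_in_uniq // => c c' ca c'a gcc'.
apply/eqP; apply: contraTT (lexx d) => /(d_sep _ _ ca c'a) h.
have [h1 _] := gP c ca; have [h2 _] := gP c' c'a.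
suff : `|c - c'| <= 2 * d by rewrite leNgt h.
have -> : c - c' = (g c' - c') - (g c - c) by rewrite gcc'; lra.
by rewrite (le_trans (ler_normB _ _)) //; lra.
Qed.

(** * Symmetric polynomials in terms of elementary symmetric values *)

Definition esymv (R : comNzRingType) (n : nat) (x : 'I_n -> R) (i : 'I_n) : R :=
  meval x (mesym n R i.+1).

Lemma sym_esym_expansion (R : realType) (n : nat) (f : mpoly n R) :
  f \is symmetric -> exists t : mpoly n R,
    (forall x, meval x f = meval (esymv x) t) /\
    {in msupp t, forall m : multinom n, (\sum_i m i * i.+1 <= degree f)%N}.
Proof.
move=> /sym_fundamental[t [<- t_wgt]]; exists t; split=> [x|m m_t].
  by rewrite comp_mpoly_meval; apply: meval_eq => i; rewrite tnth_mktuple.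
have := leq_trans (mmeasure_mnm_lt _ m_t) t_wgt.
by rewrite /degree /mnmwgt; case: (mmeasure _ _).
Qed.

Lemma sym_low_degree (R : realType) (n k : nat) (f : mpoly n R)
    (x y : 'I_n -> R) :
  f \is symmetric -> (degree f <= k)%N ->
  (forall i : 'I_n, (i < k)%N -> esymv x i = esymv y i) ->
  meval x f = meval y f.
Proof.
move=> /sym_esym_expansion[t [ft t_wgt]] fk exy; rewrite !ft !mevalE.
apply: eq_big_seq => m /t_wgt m_wgt; congr (_ * _); apply: eq_bigr => i _.
have [/exy->//|le_ki] := ltnP i k.
move: m_wgt; rewrite (bigD1 i) //=.
by case: (m i) => [|mi]; [rewrite !expr0|lia].
Qed.

(** With the first [k] elementary symmetric values frozen, a symmetric
polynomial of degree less than 2(k+1) is affine in the others.  The midpoint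
form of affineness is what the descent needs, and it can be checked one monomial
at a time without naming the linear part. *)
Lemma sym_midpoint (R : realType) (n k : nat) (f : mpoly n R)
    (x y z : 'I_n -> R) :
  f \is symmetric -> (degree f < k.+1.*2)%N ->
  (forall i : 'I_n, (i < k)%N ->
     esymv y i = esymv x i /\ esymv z i = esymv x i) ->
  (forall i, esymv y i + esymv z i = esymv x i *+ 2) ->
  meval y f + meval z f = meval x f *+ 2.
Proof.
move=> /sym_esym_expansion[t [ft t_wgt]] fk exyz eD; rewrite !ft !mevalE.
rewrite -big_split -sumrMnl; apply: eq_big_seq => m /t_wgt m_wgt /=.
rewrite -mulrDr -mulrnAr; congr (_ * _).
have [/existsP[i /andP[le_ki mi_gt0]]|/existsPn m_low] :=
    boolP [exists i : 'I_n, (k <= i)%N && (0 < m i)%N]; last first.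
  rewrite mulr2n; congr (_ + _); apply: eq_bigr => i _;
  (have [/exyz[yi zi]|le_ki] := ltnP i k; first by rewrite ?yi ?zi);
  by have := m_low i; rewrite le_ki lt0n negbK => /eqP->; rewrite !expr0.
(* A monomial with an index [i] beyond [k] is linear in it, and has no other
   such index: its weight would reach 2(k+1). *)
move: m_wgt; rewrite (bigD1 i) //= => m_wgt.
have mi1 : m i = 1%N by nia.
rewrite !(bigD1 (P := xpredT) i) //= mi1 !expr1.
have same (u : 'I_n -> R) : u =1 esymv y \/ u =1 esymv z ->
    \prod_(j | j != i) u j ^+ m j = \prod_(j | j != i) esymv x j ^+ m j.
  move=> u_yz; apply: eq_bigr => j ne_ji; have [lt_jk|le_kj] := ltnP j k.
    by case: u_yz => ->; have [yj zj] := exyz j lt_jk; rewrite ?yj ?zj.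
  suff -> : m j = 0%N by rewrite !expr0.
  apply/eqP; rewrite -leqn0 leqNgt; apply/negP => mj_gt0.
  move: m_wgt; rewrite (bigD1 j) //=; nia.
by rewrite (same (esymv y)) ?(same (esymv z)) -?mulrDl ?eD ?mulrnAl; auto.
Qed.

Lemma esym_roots_coef (R : idomainType) (n : nat) (s : n.-tuple R) (i : 'I_n) :
  esymv (tnth s) i =
    (-1) ^+ i.+1 * (\prod_(c <- s) ('X - c%:P))`_(n - i.+1).
Proof.
rewrite (mroots_coeff s (Ordinal (ltn_ord i : i.+1 < n.+1)%N)).
by rewrite mulrA -exprMn mulrNN mulr1 expr1n mul1r.
Qed.

(** A point with [r] distinct coordinates in the open set [U] can be moved along
a whole segment in the space of elementary symmetric values, in a direction
that leaves the first [r - 1] of them unchanged.  If P is the product of T - c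
over the [r] values and Q is the cofactor of P in prod_i (T - x_i), the motion
is Q (P + t e) with e > 0 small; the direction comes from the coefficients of
e Q, and its nonzero entry from the leading coefficient of Q. *)
Lemma codom_perturbation (R : realType) (n : nat) (U : pred R) (x : 'I_n -> R)
    (r := size (undup [seq c <- codom x | U c])) :
  (0 < r)%N ->
  (forall c, U c -> exists2 e, 0 < e & forall b, `|b - c| <= e -> U b) ->
  exists2 v : 'I_n -> R,
    (forall i : 'I_n, (i.+1 < r)%N -> v i = 0) /\ (exists i, v i != 0) &
    forall t, `|t| <= 1 -> exists2 z : 'I_n -> R,
      forall i, U (z i) \/ z i \in codom x &
      forall i, esymv z i = esymv x i + t * v i.
Proof.
move=> r_gt0 U_open; pose a := undup [seq c <- codom x | U c].
have aU : {in a, forall c, U c}.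
  by move=> c; rewrite mem_undup mem_filter => /andP[].
have /perm_to_subseq[s perm_x] : subseq a (codom x).
  exact: subseq_trans (undup_subseq _) (filter_subseq _ _).
have [|e e_gt0 eP] := @perturb_simple_roots R U a (undup_uniq _) r_gt0.
  by move=> c /aU/U_open.
pose Q := \prod_(c <- s) ('X - c%:P) : {poly R}.
have size_as : (r + size s = n)%N.
  by rewrite -size_cat -(perm_size perm_x) size_codom card_ord.
pose xt := [tuple x i | i < n].
have xtE : \prod_(c <- xt) ('X - c%:P) = \prod_(c <- a) ('X - c%:P) * Q.
  by rewrite /= -big_cat -(perm_big _ perm_x) /= codomE.
exists (fun i : 'I_n => (-1) ^+ i.+1 * (e * Q`_(n - i.+1))).
  split=> [i lt_ir|].
    rewrite nth_default ?mulr0 //; rewrite size_prod_XsubC; lia.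
  have lt_rn : (r.-1 < n)%N by lia.
  exists (Ordinal lt_rn) => /=; rewrite mulf_eq0 signr_eq0 /=.
  have -> : (n - r.-1.+1 = (size Q).-1)%N by rewrite size_prod_XsubC; lia.
  by rewrite -lead_coefE (monicP (monic_prod_XsubC _ _ _)) mulr1 gt_eqF.
move=> t t1; have [|b [size_b bU bP]] := eP (t * e).
  by rewrite normrM (gtr0_norm e_gt0) ler_piMl // ltW.
have size_bs : size (b ++ s) == n by rewrite size_cat size_b -/r size_as.
exists (tnth (Tuple size_bs)) => [i|i].
  have := mem_tnth i (Tuple size_bs); rewrite memtE /= mem_cat.
  move=> /orP[/(allP bU)|si]; first by left.
  by right; rewrite (perm_mem perm_x) mem_cat si orbT.
have -> : esymv x i = esymv (tnth xt) i.
  by apply: meval_eq => j; rewrite tnth_mktuple.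
rewrite !esym_roots_coef xtE big_cat /= bP mulrDl coefD mulrDr; congr (_ + _).
by rewrite mul_polyC coefZ -!mulrA mulrCA.
Qed.

(** * Descent to points with few distinct coordinates *)

Lemma continuous_meval (R : realType) (T : topologicalType) (n : nat)
    (f : mpoly n R) (g : T -> 'I_n -> R) :
  (forall i, continuous (g ^~ i)) -> continuous (fun x => meval (g x) f).
Proof.
move=> g_cont; under [X in continuous X]eq_fun do rewrite mevalE.
apply: continuous_big => [|m _]; first exact: add_continuous.
move=> x; apply: continuousM; first exact: cst_continuous.
apply: continuous_big => [|i _]; first exact: mul_continuous.
move=> {}x.
apply: (@continuous_comp _ _ _ (g ^~ i) (@GRing.exp R ^~ (m i))).
  exact: g_cont.
exact: exprn_continuous.
Qed.

Lemma sum_sqr_parallelogram (R : realFieldType) (n : nat) (u v : 'I_n -> R) :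
  \sum_i (u i + v i) ^+ 2 + \sum_i (u i - v i) ^+ 2 =
  (\sum_i u i ^+ 2) *+ 2 + (\sum_i v i ^+ 2) *+ 2.
Proof.
rewrite -!sumrMnl -!big_split /=; apply: eq_bigr => i _.
by lra.
Qed.

(** The set [D] of allowed values and its subset [U] of values that can be moved
freely are kept abstract: both are all of R for points of R^n, and they are
the nonnegative and the positive reals for points of the orthant. *)
Lemma half_degree_descent (R : realType) (n k : nat) (U : pred R) (D : set R)
    (f : mpoly n R) (y : 'I_n -> R) :
  closed D -> (forall c, U c -> D c) ->
  (forall c, U c -> exists2 e, 0 < e & forall b, `|b - c| <= e -> U b) ->
  f \is symmetric -> (degree f < k.+1.*2)%N ->
  (forall i, D (y i)) ->
  (exists B, forall x : 'I_n -> R, (forall i, D (x i)) ->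
     (forall i : 'I_n, (i < k)%N -> esymv x i = esymv y i) ->
     forall i, `|x i| <= B) ->
  exists x : 'I_n -> R, [/\ forall i, D (x i),
    (size (undup [seq c <- codom x | U c]) <= k)%N & meval x f <= meval y f].
Proof.
move=> D_closed UD U_open f_sym f_deg Dy [B xB].
pose K := [set x : 'rV[R]_n | (forall i, D (x ord0 i)) /\
  forall i : 'I_n, (i < k)%N -> esymv (x ord0) i = esymv y i].
have esym_cont i : continuous (fun x : 'rV[R]_n => esymv (x ord0) i).
  by apply: continuous_meval => j; exact: coord_continuous.
have f_cont : continuous (fun x : 'rV[R]_n => meval (x ord0) f).
  by apply: continuous_meval => j; exact: coord_continuous.
have K_compact : compact K.
  have box_compact := @rV_compact R n _ (fun=> @segment_compact R (- B) B).
  apply: subclosed_compact box_compact _ => [|x [Dx ex] i]; last first.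
    by rewrite /= in_itv /= -ler_norml; exact: xB.
  have -> : K = \bigcap_i (fun x : 'rV[R]_n => x ord0 i) @^-1` D `&`
     \bigcap_(i in [set i : 'I_n | (i < k)%N])
       (fun x : 'rV[R]_n => esymv (x ord0) i) @^-1` [set esymv y i].
    apply/seteqP; split=> x [h1 h2]; split=> i.
    - by move=> _; exact: h1.
    - by move=> ?; exact: h2.
    - exact: h1.
    - exact: h2.
  apply: closedI; apply: closed_bigI => i _; apply: preimage_closed => // x _.
  exact: coord_continuous.
have yrow : (\row_i y i) ord0 =1 y by move=> i; rewrite mxE.
have K_y : K (\row_i y i).
  by split=> i; rewrite ?mxE // => _; apply: meval_eq.
have [x1 K_x1 x1_min] := compact_EVT_min
  (ex_intro _ _ K_y) K_compact (continuous_subspaceT f_cont).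
pose K' := K `&`
  (fun x : 'rV[R]_n => meval (x ord0) f) @^-1` [set meval (x1 ord0) f].
rewrite inE in K_x1.
have K'_compact : compact K'.
  apply: compact_closedI => //.
  by apply: preimage_closed.
(* Strict convexity of [N] forces a maximiser of [N] among the minimisers of
   [f] to be extreme: it is not a midpoint of two other minimisers. *)
pose N (x : 'rV[R]_n) := \sum_i esymv (x ord0) i ^+ 2.
have N_cont : continuous N.
  apply: continuous_big => [|i _]; first exact: add_continuous.
  move=> x; apply: (@continuous_comp _ _ _
    (fun x : 'rV[R]_n => esymv (x ord0) i) (@GRing.exp R ^~ 2)).
    exact: esym_cont.
  exact: exprn_continuous.
have [|x K'_x x_max] := compact_EVT_max _ K'_compact
  (continuous_subspaceT N_cont).
  by exists x1.
rewrite inE in K'_x; have [[Dx ex] fx] := K'_x; rewrite /= in fx.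
exists (x ord0); split=> //; last first.
  by rewrite fx -(meval_eq _ yrow); apply: x1_min; rewrite inE.
rewrite leqNgt; apply/negP => lt_k.
have [v [v_low [i0 v_i0]] vP] := codom_perturbation
  (leq_ltn_trans (leq0n k) lt_k) U_open.
have step t : `|t| <= 1 -> exists2 z, K z &
    forall i, esymv (z ord0) i = esymv (x ord0) i + t * v i.
  move=> /vP[z z_mem ez].
  have zrow : (\row_i z i) ord0 =1 z by move=> i; rewrite mxE.
  exists (\row_i z i); last by move=> i; rewrite -ez; apply: meval_eq.
  split=> i; first by rewrite mxE; case: (z_mem i) => [/UD//|/codomP[j ->]].
  move=> lt_ik; have vi0 : v i = 0 by apply: v_low; exact: leq_ltn_trans lt_k.
  rewrite -ex // -[RHS]addr0 -[X in _ + X](mulr0 t) -vi0 -ez.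
  exact: meval_eq.
have [|z1 Kz1 ez1] := step 1; first by rewrite normr1.
have [|z2 Kz2 ez2] := step (-1); first by rewrite normrN1.
have fz : meval (z1 ord0) f + meval (z2 ord0) f = meval (x ord0) f *+ 2.
  apply: sym_midpoint f_sym f_deg _ _ => i; last by rewrite ez1 ez2; lra.
  by move=> lt_ik; rewrite (proj2 Kz1) // (proj2 Kz2) // ex.
have fz1 : meval (x1 ord0) f <= meval (z1 ord0) f by apply: x1_min; rewrite inE.
have fz2 : meval (x1 ord0) f <= meval (z2 ord0) f by apply: x1_min; rewrite inE.
have Nz1 : N z1 <= N x by apply: x_max; rewrite inE; split=> //=; lra.
have Nz2 : N z2 <= N x by apply: x_max; rewrite inE; split=> //=; lra.
have := sum_sqr_parallelogram (esymv (x ord0)) v.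
have -> : \sum_i (esymv (x ord0) i + v i) ^+ 2 = N z1.
  by apply: eq_bigr => i _; rewrite ez1 mul1r.
have -> : \sum_i (esymv (x ord0) i - v i) ^+ 2 = N z2.
  by apply: eq_bigr => i _; rewrite ez2 mulN1r.
rewrite -/(N x).
have : 0 < \sum_i v i ^+ 2.
  rewrite (bigD1 i0) //= ltr_wpDr ?sumr_ge0 ?exprn_even_gt0 //= => i _.
  exact: sqr_ge0.
by lra.
Qed.

Definition power_sum (R : comNzRingType) (n j : nat) : mpoly n R :=
  \sum_(i < n) mpolyX R (mnm1 i) ^+ j.

Lemma power_sum_sym (R : comNzRingType) (n j : nat) :
  power_sum R n j \is symmetric.
Proof.
apply/issymP => s; rewrite raddf_sum /= [RHS](reindex_inj (@perm.perm_inj _ s)).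
by apply: eq_bigr => i _; rewrite rmorphXn /= /msym mmapX mmap1U.
Qed.

Lemma meval_power_sum (R : comNzRingType) (n j : nat) (x : 'I_n -> R) :
  meval x (power_sum R n j) = \sum_i x i ^+ j.
Proof.
by rewrite raddf_sum; apply: eq_bigr => i _ /=; rewrite rmorphXn /= mevalXU.
Qed.

Lemma degree_power_sum (R : realType) (n j : nat) :
  (degree (power_sum R n j) <= j)%N.
Proof.
suff : (mmeasure mdeg (power_sum R n j) <= j.+1)%N.
  by rewrite /degree; case: (mmeasure _ _).
apply: leq_trans (mmeasure_sum _ _ _ _) _; apply/bigmax_leqP => i _.
by rewrite mpolyXn msizeX mdegMn mdeg1 mul1n.
Qed.

(** This replaces Newton's identities: power sums are symmetric of low
degree. *)
Lemma eq_esym_power_sum (R : realType) (n k j : nat) (x y : 'I_n -> R) :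
  (j <= k)%N -> (forall i : 'I_n, (i < k)%N -> esymv x i = esymv y i) ->
  \sum_i x i ^+ j = \sum_i y i ^+ j.
Proof.
move=> le_jk exy; rewrite -!meval_power_sum.
apply: sym_low_degree exy; first exact: power_sum_sym.
exact: leq_trans (degree_power_sum _ _ _) le_jk.
Qed.

(** Here k >= 2 is used to bound the fibres, through the sum of the squares. *)
Lemma descent_all (R : realType) (n k : nat) (f : mpoly n R) (y : 'I_n -> R) :
  f \is symmetric -> (1 < k)%N -> (degree f < k.+1.*2)%N ->
  exists2 x, Aset k x & meval x f <= meval y f.
Proof.
move=> f_sym k_gt1 f_deg.
have [|||||x [_ x_k fx]] := @half_degree_descent R n k
  predT setT f y _ _ _ f_sym f_deg.
- exact: closedT.
- by [].
- by move=> c _; exists 1.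
- by [].
(* [`|a| <= 1 + a ^+ 2] avoids a square root. *)
- exists (1 + \sum_i y i ^+ 2) => x _ exy i.
  have : x i ^+ 2 <= \sum_i y i ^+ 2.
    rewrite -(eq_esym_power_sum k_gt1 exy) (bigD1 i) //= lerDl.
    by apply: sumr_ge0 => j _; exact: sqr_ge0.
  by case: ger0P; nra.
by exists x => //; rewrite filter_predT in x_k.
Qed.

(** For nonnegative coordinates the sum of the coordinates bounds the fibres, so
that k >= 1 suffices. *)
Lemma descent_orthant (R : realType) (n k : nat) (f : mpoly n R)
    (y : 'I_n -> R) :
  f \is symmetric -> (0 < k)%N -> (degree f < k.+1.*2)%N ->
  nonneg_orthant y -> exists2 x, Aset_pos k x & meval x f <= meval y f.
Proof.
move=> f_sym k_gt0 f_deg y_ge0.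
have [||||x [x_ge0 x_k fx]] := @half_degree_descent R n k
  (fun c => 0 < c) [set c | 0 <= c] f y _ _ _ f_sym f_deg y_ge0.
- exact: closed_ge.
- by move=> c /ltW.
- move=> c c_gt0; exists (c / 2); first lra.
  by move=> b; rewrite ler_norml; lra.
- exists (\sum_i y i ^+ 1) => x x_ge0 exy i.
  rewrite ger0_norm; last exact: x_ge0.
  rewrite -(eq_esym_power_sum k_gt0 exy) (bigD1 i) //= expr1 lerDl.
  by apply: sumr_ge0 => j _; exact: x_ge0.
by exists x.
Qed.

Lemma size_undup_map (T T' : eqType) (h : T -> T') (s : seq T) :
  (size (undup (map h s)) <= size (undup s))%N.
Proof.
rewrite -(size_map h); apply: uniq_leq_size (undup_uniq _) _ => c.
rewrite mem_undup => /mapP[b s_b ->]; by apply: map_f; rewrite mem_undup.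
Qed.

(** [Aset k] is stable under scaling, so the segment from the origin to [x]
stays in it. *)
Lemma zero_on_ray (R : realType) (n k : nat) (f : mpoly n R) (x : 'I_n -> R) :
  Aset k x -> meval (fun=> 0) f * meval x f <= 0 ->
  zero_locus f `&` Aset k !=set0.
Proof.
move=> x_k f0x; pose g (t : R) i := t * x i.
have g_cont : continuous (fun t => meval (g t) f).
  by apply: continuous_meval => i t; exact: mulrr_continuous.
have [|t _ ft] := @IVT R _ 0 1 0 ler01 (continuous_subspaceT g_cont).
  rewrite (meval_eq (v2 := fun=> 0)) => [|i]; last by rewrite /g mul0r.
  rewrite (meval_eq (v1 := g 1) (v2 := x)) => [|i]; last by rewrite /g mul1r.
  rewrite ge_min le_max; move: f0x; set u := meval _ _; set v := meval _ _.
  have [u0|u0] := lerP u 0; have [v0|v0] := lerP v 0; rewrite ?orbT /=; nra.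
exists (g t); split=> //=; apply: leq_trans x_k.
by rewrite /num_distinct /codom /image_mem map_comp; exact: size_undup_map.
Qed.

(** * The half-degree principle *)

Theorem theorem3p1 (R : realType) (n d : nat) (f : mpoly n R)
    (f_sym : f \is symmetric) (f_deg : degree f = d) :
  [/\ (forall y : 'I_n -> R, 0 <= meval y f) <->
        (forall y : 'I_n -> R, Aset (maxn 2 (d %/ 2)) y -> 0 <= meval y f),
      (forall y : 'I_n -> R, nonneg_orthant y -> 0 <= meval y f) <->
        (forall y : 'I_n -> R, Aset_pos (maxn 1 (d %/ 2)) y ->
           0 <= meval y f)
    & zero_locus f !=set0 <->
        zero_locus f `&` Aset (maxn 2 (d %/ 2)) !=set0].
Proof.
set k2 := maxn 2 _; set k1 := maxn 1 _.
have deg_k2 : (degree f < k2.+1.*2)%N by rewrite f_deg /k2; lia.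
have deg_k1 : (degree f < k1.+1.*2)%N by rewrite f_deg /k1; lia.
have k2_gt1 : (1 < k2)%N by rewrite leq_maxl.
have k1_gt0 : (0 < k1)%N by rewrite leq_maxl.
split; [split=> f_ge0 y|split=> f_ge0 y y_ge0|split=> [[y fy]|[y [fy _]]]].
- by move=> _; exact: f_ge0.
- have [x x_k /(le_trans _)->//] := descent_all y f_sym k2_gt1 deg_k2.
  exact: f_ge0.
- by apply: f_ge0; case: y_ge0.
- have [x x_k /(le_trans _)->//] := descent_orthant f_sym k1_gt0 deg_k1 y_ge0.
  exact: f_ge0.
- have [f0_le0|f0_gt0] := lerP (meval (fun=> 0) f) 0.
    have Nf_sym : - f \is symmetric by rewrite rpredN.
    have deg_Nf : (degree (- f) < k2.+1.*2)%N by rewrite /degree mmeasureN.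
    have [x x_k] := descent_all y Nf_sym k2_gt1 deg_Nf.
    rewrite !mevalN fy oppr0 oppr_le0 => fx_ge0.
    by apply: zero_on_ray x_k _; rewrite mulr_le0_ge0.
  have [x x_k fx_le0] := descent_all y f_sym k2_gt1 deg_k2.
  apply: zero_on_ray x_k _; rewrite mulr_ge0_le0 //; first exact: ltW.
  by rewrite -fy.
- by exists y.
Qed.
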